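(* Let $(W,S)$ be a Coxeter system of rank $n$ whose associated bilinear form $B$ has signature $(n-1,1)$ and is irreducible. Then the limit set $\Lambda(W)$ of $W$ coincides with the set $E(W)$ of accumulation points of the normalized roots of $W$.
   Context: Coxeter system: $W$ is generated by $S=\{s_1,\dots,s_n\}$ with relations $(s_is_j)^{m_{ij}}=1$, where $m_{ii}=1$ and $m_{ij}=m_{ji}\in\{2,3,\dots\}\cup\{\infty\}$ for $i\ne j$ (no relation if $m_{ij}=\infty$). $V$ is a real vector space with basis $\Delta=\{\alpha_1,\dots,\alpha_n\}$, declared orthonormal for a Euclidean inner product. $B$ is a symmetric bilinear form on $V$ with $B(\alpha_i,\alpha_j)=-\cos(\pi/m_{ij})$ if $m_{ij}<\infty$ (so $B(\alpha_i,\alpha_i)=1$) and $B(\alpha_i,\alpha_j)$ a fixed real number $\le -1$ if $m_{ij}=\infty$. $B$ is irreducible if its Gram matrix $(B(\alpha_i,\alpha_j))_{i,j}$ is not block-diagonal up to permutation of the basis. Signature $(p,q)$ means $p$ positive and $q$ negative eigenvalues. $W$ acts linearly on $V$ by letting $s_i$ act as $v\mapsto v-2B(\alpha_i,v)\alpha_i$; the image of $v$ under $w$ is written $w(v)$. The root system is $\Phi=W(\Delta)$. Let $o=\sum_i o_i\alpha_i$ be the eigenvector for the negative eigenvalue of the Gram matrix with Euclidean norm $1$ and all $o_i>0$ (it exists under the assumptions). For $v=\sum_i v_i\alpha_i$ put $|v|_1=\sum_i o_iv_i$, let $V_1=\{v\in V: |v|_1=1\}$, and $\widehat v=v/|v|_1$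 when $|v|_1\neq0$ (which holds for all roots). Let $D=\{v\in V_1: B(v,v)<0\}$; the normalized action of $W$ on $D$ is $w\cdot x=\widehat{w(x)}$. The limit set $\Lambda(W)$ is the set of accumulation points of the orbit $W\cdot o$ in the Euclidean topology. $E(W)$ is the set of accumulation points of $\widehat\Phi=\{\widehat\rho:\rho\in\Phi\}$ in the Euclidean topology. *)

(* Defs.v *)
From HB Require Import structures.
From mathcomp Require Import all_boot all_order all_algebra all_fingroup.
From mathcomp Require Import all_classical all_reals all_analysis.

Set Implicit Arguments.
Unset Strict Implicit.
Unset Printing Implicit Defensive.

Import Order.TTheory GRing.Theory Num.Theory.
Import numFieldNormedType.Exports.
Local Open Scope classical_set_scope.
Local Open Scope ring_scope.

(* An entry [None] of a Coxeter matrix stands for m_ij = oo. *)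
Definition coxeter_matrix (n : nat) (m : 'I_n -> 'I_n -> option nat) : Prop :=
  [/\ forall i, m i i = Some 1%N,
      forall i j, m i j = m j i &
      forall i j k, i != j -> m i j = Some k -> (2 <= k)%N].

Definition coxeter_relations (n : nat) (m : 'I_n -> 'I_n -> option nat)
    (W : groupType) (s : 'I_n -> W) : Prop :=
  forall i j k, m i j = Some k -> ((s i * s j) ^+ k = 1)%g.

Definition generates (I : Type) (W : groupType) (s : I -> W) : Prop :=
  forall A : set W, A 1%g -> (forall x y, A x -> A y -> A (x * y^-1)%g) ->
    (forall i, A (s i)) -> A = setT.

(* The last field is the universal property of the group presented by the
   generators s_i and the relations (s_i s_j)^(m_ij) = 1. *)
Record coxeter_system (n : nat) (m : 'I_n -> 'I_n -> option nat)
    (W : groupType) (s : 'I_n -> W) : Prop := CoxeterSystem {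
  coxeter_system_matrix : coxeter_matrix m;
  coxeter_system_gen : generates s;
  coxeter_system_rel : coxeter_relations m s;
  coxeter_system_univ : forall (H : groupType) (f : 'I_n -> H),
    coxeter_relations m f ->
    exists phi : {multiplicative W -> H}, forall i, phi (s i) = f i
}.

Section CoxeterGeometry.
Context (R : realType) (n : nat).
Implicit Types (G : 'M[R]_n) (m : 'I_n -> 'I_n -> option nat).

(* V is identified with 'cV[R]_n through its basis Delta. *)
Definition simple_root (i : 'I_n) : 'cV[R]_n := delta_mx i 0.

(* G is a Gram matrix (B(alpha_i, alpha_j))_(i,j) of a form associated with m. *)
Definition coxeter_gram m G : Prop :=
  [/\ G^T = G,
      forall i j k, m i j = Some k -> G i j = - cos (pi / k%:R) &
      forall i j, m i j = None -> G i j <= - 1].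

Definition bform G (u v : 'cV[R]_n) : R := (u^T *m G *m v) 0 0.

(* The list l enumerates the eigenvalues of G with multiplicity. *)
Definition has_signature G (p q : nat) : Prop :=
  exists l : seq R,
    [/\ char_poly G = \prod_(x <- l) ('X - x%:P),
        count (fun x => 0 < x) l = p &
        count (fun x => x < 0) l = q].

Definition block_diagonal_up_to_perm G : Prop :=
  exists (sigma : 'S_n) (k : nat), (0 < k < n)%N /\
    forall i j : 'I_n, (i < k)%N != (j < k)%N -> G (sigma i) (sigma j) = 0.

Definition irreducible_form G : Prop := ~ block_diagonal_up_to_perm G.

(* This determines rho as soon as the s_i generate W. *)
Definition geometric_representation G (W : groupType) (s : 'I_n -> W)
    (rho : W -> 'M[R]_n) : Prop :=
  [/\ rho 1%g = 1%:M,
      forall x y, rho (x * y)%g = rho x *m rho y &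
      forall i v, rho (s i) *m v =
        v - (2 * bform G (simple_root i) v) *: simple_root i].

Definition roots (W : groupType) (rho : W -> 'M[R]_n) : set 'cV[R]_n :=
  [set r | exists w i, r = rho w *m simple_root i].

Definition positive_unit_negative_eigenvector G (o : 'cV[R]_n) : Prop :=
  [/\ exists2 lambda : R, lambda < 0 & G *m o = lambda *: o,
      \sum_i o i 0 ^+ 2 = 1 &
      forall i, 0 < o i 0].

Definition norm1 (o v : 'cV[R]_n) : R := \sum_i o i 0 * v i 0.

Definition normalize (o v : 'cV[R]_n) : 'cV[R]_n := (norm1 o v)^-1 *: v.

Definition normalized_orbit (W : groupType) (rho : W -> 'M[R]_n)
    (o : 'cV[R]_n) : set 'cV[R]_n :=
  [set x | exists w, x = normalize o (rho w *m o)].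

Definition limit_set (W : groupType) (rho : W -> 'M[R]_n) (o : 'cV[R]_n) :
    set 'cV[R]_n :=
  limit_point (normalized_orbit rho o).

Definition normalized_roots_limit (W : groupType) (rho : W -> 'M[R]_n)
    (o : 'cV[R]_n) : set 'cV[R]_n :=
  limit_point (normalize o @` roots rho).

End CoxeterGeometry.

(* Main.v *)
(* Let [B] be the form, [lambda < 0] the eigenvalue of [o] and [|v|_1] the height of
   [v], so that [B(o, v) = lambda |v|_1]. As [B] is positive definite on the
   orthogonal complement of [o], a vector is bounded in terms of its height and of
   its [B]-norm. By Tits' theorem (a root is positive or negative according to
   whether the simple reflection lengthens the word) no [w <> 1] keeps [o] inside
   the chamber [B(alpha_i, -) < 0]; hence [W] is discrete, and only finitely many
   points of [W o] and finitely many normalized roots have bounded height. Limit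
   points are therefore approached along heights tending to infinity. Finally
   [B(w o, w alpha_i) = lambda o_i] is bounded, so after normalization [w o] and
   [w alpha_i] become isotropic, [B]-orthogonal and of height 1, which forces them
   to be close to each other. *)
From mathcomp Require Import all_boot all_order all_algebra all_fingroup.
From mathcomp Require Import all_classical all_reals all_analysis.
From mathcomp Require Import complex zify ring lra.
Require Import Defs.
Set Implicit Arguments.
Unset Strict Implicit.
Unset Printing Implicit Defensive.
Import Order.TTheory GRing.Theory Num.Theory.
Import numFieldNormedType.Exports.
Local Open Scope classical_set_scope.
Local Open Scope ring_scope.

(** * Word length *)

Section Length.
Context (n : nat) (W : groupType) (s : 'I_n -> W).
Hypothesis s_invol : forall i, (s i * s i = 1)%g.
Hypothesis s_gen : generates s.
Local Open Scope nat_scope.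
Local Open Scope group_scope.

Fixpoint has_word (k : nat) (g : W) : Prop :=
  if k is k'.+1 then exists h i, has_word k' h /\ g = h * s i else g = 1.

Lemma has_word_gen i : has_word 1%N (s i).
Proof. by exists 1, i; rewrite mul1g. Qed.

Lemma has_wordM j k g h : has_word j g -> has_word k h -> has_word (j + k) (g * h).
Proof.
move=> jg; elim: k h => [|k IH] h /=; first by move=> ->; rewrite addn0 mulg1.
move=> [h' [i [kh ->]]]; rewrite addnS; exists (g * h'), i.
by split; [exact: IH | rewrite mulgA].
Qed.

Lemma gen_inv i : (s i)^-1 = s i.
Proof. by apply: (mulgI (s i)); rewrite mulgV s_invol. Qed.

Lemma has_wordV k g : has_word k g -> has_word k g^-1.
Proof.
elim: k g => [|k IH] g /=; first by move=> ->; rewrite invg1.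
move=> [h [i [kh ->]]]; rewrite invgM gen_inv.
exact: (has_wordM (has_word_gen i) (IH _ kh)).
Qed.

(** Elements with a word are closed under [x * y^-1] because the generators are involutions: an
    inverse is spelled by the reversed word. *)
Lemma has_word_exists g : exists k, `[< has_word k g >].
Proof.
have := @s_gen [set g | exists k, has_word k g].
move=> /(_ _ _ _)/seteqP[]; first by exists 0%N.
- move=> x y [j jx] [k ky]; exists (j + k)%N.
  exact: (has_wordM jx (has_wordV ky)).
- by move=> i; exists 1%N; exact: has_word_gen.
- by move=> _ /(_ g I)[k kg]; exists k; apply/asboolP.
Qed.

Definition word_length g := ex_minn (has_word_exists g).

Lemma word_lengthP g : has_word (word_length g) g.
Proof. by rewrite /word_length; case: ex_minnP => k /asboolP. Qed.

Lemma word_length_min k g : has_word k g -> word_length g <= k.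
Proof.
by move=> kg; rewrite /word_length; case: ex_minnP => l _; apply; apply/asboolP.
Qed.

Lemma word_lengthM k g h : has_word k h -> word_length (g * h) <= word_length g + k.
Proof. by move=> kh; apply/word_length_min/has_wordM => //; exact: word_lengthP. Qed.

Lemma mulgsK g i : g * s i * s i = g.
Proof. by rewrite -mulgA s_invol mulg1. Qed.

Lemma exists_descent g : g <> 1 -> exists i, word_length (g * s i) < word_length g.
Proof.
have := word_lengthP g; case: (word_length g) => [|k] //= [h [i [kh ->]]] _.
by exists i; rewrite mulgsK ltnS word_length_min.
Qed.

(* The alternating word of length [k] whose rightmost letter is [s j]. *)
Fixpoint alternating (i j : 'I_n) (k : nat) : W :=
  if k is k'.+1 then s (if odd k' then i else j) * alternating i j k' else 1.

Lemma has_word_alternating i j k : has_word k (alternating i j k).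
Proof.
elim: k => [//|k IH].
exact: (has_wordM (has_word_gen (if odd k then i else j)) IH).
Qed.

Lemma alternatingSr i j k : alternating i j k.+1 = alternating j i k * s j.
Proof.
elim: k => [|k IH]; first by rewrite /= mulg1 mul1g.
by rewrite [LHS]/= -[s (if odd k then i else j) * _]/(alternating i j k.+1) IH
  /= mulgA; case: (odd k).
Qed.

Lemma alternating_suffix i j d k :
  exists2 y, has_word d y & alternating i j (d + k) = y * alternating i j k.
Proof.
elim: d => [|d [y dy eq_y]]; first by exists 1; rewrite ?mul1g.
exists (s (if odd (d + k) then i else j) * y).
  exact: (has_wordM (has_word_gen _) dy).
by rewrite addSn /= eq_y mulgA.
Qed.

(** Inverting the second word reverses it, so the product is an alternating word of length [2k]; the
    parity of [k] decides its first letter. *)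
Lemma alternating_quotient i j k :
  alternating i j k * (alternating j i k)^-1 =
    if odd k then (s j * s i) ^+ k else (s i * s j) ^+ k.
Proof.
elim: k => [|k IH]; first by rewrite /= expg0 invg1 mulg1.
rewrite /= invgM gen_inv mulgA -[s _ * _ * _]mulgA IH.
have conj_exp (a b : W) : a * (b * a) ^+ k * b = (a * b) ^+ k.+1.
  elim: k {IH} => [|k IH]; first by rewrite expg0 mulg1 expg1.
  by rewrite (expgSr (b * a)) (expgSr (a * b)) -IH !mulgA.
by case: (odd k); rewrite /= conj_exp.
Qed.

Lemma braid i j k : (s i * s j) ^+ k = 1 -> alternating i j k = alternating j i k.
Proof.
move=> ijk; apply: (mulIg (alternating j i k)^-1); rewrite mulgV alternating_quotient ijk.
have -> : s j * s i = (s i * s j)^-1 by rewrite invgM !gen_inv.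
by rewrite expVgn ijk invg1 if_same.
Qed.

(** [v] plays the role of the minimal representative of the coset of [w] under the dihedral subgroup
    of [s i] and [s j]. It arises by stripping from the right of [w] the longest alternating word
    whose removal is length-additive. The last clause keeps [k] below the order of [s i * s j],
    which later makes the dihedral coefficients nonnegative. *)
Lemma dihedral_decomposition w i j :
  word_length w <= word_length (w * s i) ->
  word_length (w * s j) < word_length w ->
  exists v k, [/\ w = v * alternating i j k, word_length v < word_length w,
    word_length v <= word_length (v * s i),
    word_length v <= word_length (v * s j) &
    forall m, 0 < m -> (s i * s j) ^+ m = 1 -> k < m].
Proof.
move=> asc_i desc_j.
(* [P k] means that some shortest word for [w] ends in the alternating word of length [k]. *)
pose P k := word_length (w * (alternating i j k)^-1) + k == word_length w.
have lw v k : w = v * alternating i j k -> word_length w <= word_length v + k.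
  by move=> ->; exact/word_lengthM/has_word_alternating.
have P1 : P 1%N.
  rewrite /P /= mulg1 gen_inv eqn_leq addn1 desc_j /=.
  by rewrite -addn1 (lw _ 1%N) //= mulg1 mulgsK.
have [|k Pk kmax] := ex_maxnP (ex_intro P 1%N P1) (m := word_length w).
  by move=> k /eqP <-; rewrite leq_addl.
have k_gt0 := kmax _ P1.
set v := w * (alternating i j k)^-1.
have wE : w = v * alternating i j k by rewrite mulgVK.
have lvk : word_length v + k = word_length w by apply/eqP.
(* A descent of [v] at the letter extending the alternating word would contradict the maximality of
   [k]. *)
have next : word_length v <= word_length (v * s (if odd k then i else j)).
  rewrite leqNgt; apply/negP => lt; suff /kmax : P k.+1 by rewrite ltnn.
  rewrite /P /= invgM gen_inv mulgA -/v eqn_leq; apply/andP; split.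
    by rewrite -lvk addnS -addSn leq_add2r.
  by apply: lw; rewrite /= mulgA mulgsK.
(* At a descent, absorbing the leftmost letter of the alternating word into [v] would give a word
   for [w] shorter than its length. *)
have prev : word_length v <= word_length (v * s (if odd k then j else i)).
  rewrite leqNgt; apply/negP => lt; case: k k_gt0 @v wE lvk lt {Pk kmax next} => // k _.
  move=> v wE lvk lt.
  suff /lw : w = v * s (if odd k.+1 then j else i) * alternating i j k by lia.
  by rewrite {1}wE /= mulgA; case: (odd k).
exists v, k; split => //; first by lia.
- by case: (odd k) next prev.
- by case: (odd k) next prev.
(* If the relation had exponent at most [k], braiding the rightmost letters would make a shortest
   word for [w] end in [s i], against [asc_i]. *)
- move=> [//|m] _ rel; rewrite ltnNge; apply/negP => le_mk.
  have [y ly altE] := alternating_suffix i j (k - m.+1) m.+1.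
  suff : word_length (w * s i) <= word_length v + (k - m.+1) + m by lia.
  rewrite subnK // in altE.
  rewrite wE altE (braid rel) alternatingSr !mulgA mulgsK.
  apply: word_length_min; apply: has_wordM; last exact: has_word_alternating.
  by apply: has_wordM => //; exact: word_lengthP.
Qed.

End Length.

(** * The geometric representation *)

Section BilinearForm.
Context (R : realType) (n : nat).
Implicit Types (G : 'M[R]_n) (u v : 'cV[R]_n).

Lemma bformDl G u1 u2 v : bform G (u1 + u2) v = bform G u1 v + bform G u2 v.
Proof. by rewrite /bform linearD /= !mulmxDl mxE. Qed.

Lemma bformDr G u v1 v2 : bform G u (v1 + v2) = bform G u v1 + bform G u v2.
Proof. by rewrite /bform mulmxDr mxE. Qed.

Lemma bformZl G a u v : bform G (a *: u) v = a * bform G u v.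
Proof. by rewrite /bform linearZ /= -!scalemxAl mxE. Qed.

Lemma bformZr G a u v : bform G u (a *: v) = a * bform G u v.
Proof. by rewrite /bform -!scalemxAr mxE. Qed.

Lemma bformNl G u v : bform G (- u) v = - bform G u v.
Proof. by rewrite -scaleN1r bformZl mulN1r. Qed.

Lemma bformNr G u v : bform G u (- v) = - bform G u v.
Proof. by rewrite -scaleN1r bformZr mulN1r. Qed.

Lemma bformC G u v : G^T = G -> bform G u v = bform G v u.
Proof.
move=> GT; rewrite /bform.
have -> : (u^T *m G *m v) 0 0 = (u^T *m G *m v)^T 0 0 by rewrite [RHS]mxE.
by rewrite !trmx_mul trmxK GT mulmxA.
Qed.

Lemma bform_simple_rootl G i v : bform G (simple_root R i) v = (G *m v) i 0.
Proof. by rewrite /bform /simple_root trmx_delta -mulmxA -rowE mxE. Qed.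

Lemma bform_simple_root G i j : bform G (simple_root R i) (simple_root R j) = G i j.
Proof. by rewrite bform_simple_rootl /simple_root -colE mxE. Qed.

End BilinearForm.

(** * Chebyshev numbers of dihedral subgroups *)

Section DihedralCoefficients.
Context (R : realType) (c : R).

(* Chebyshev numbers: [sin (k * theta) / sin theta] when [c = cos theta]. *)
Fixpoint cheb (k : nat) : R :=
  match k with
  | 0 => 0
  | k'.+1 => if k' is k''.+1 then 2 * c * cheb k' - cheb k'' else 1
  end.

Lemma chebSS k : cheb k.+2 = 2 * c * cheb k.+1 - cheb k.
Proof. by []. Qed.

(** Here the sequence is nondecreasing, since [cheb k.+2 - cheb k.+1 = 2 * (c - 1) * cheb k.+1 +
    (cheb k.+1 - cheb k)]; this settles the case of infinite [m_ij]. *)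
Lemma cheb_ge0_of_ge1 k : 1 <= c -> 0 <= cheb k.
Proof.
move=> c_ge1; suff : 0 <= cheb k <= cheb k.+1 by case/andP.
elim: k => [|k /andP[IH1 IH2]]; first by rewrite lexx ler01.
rewrite (le_trans IH1 IH2) chebSS andTb.
have : 0 <= (c - 1) * cheb k.+1 by rewrite mulr_ge0 ?subr_ge0 // (le_trans IH1).
by move: (cheb k.+1) (cheb k) IH1 IH2 => x y; nra.
Qed.

End DihedralCoefficients.

(** The recursion for [cheb] is the addition formula for sines. Being of order two, it carries two
    consecutive indices through the induction. *)
Lemma cheb_cos (R : realType) (t : R) k : cheb (cos t) k * sin t = sin (t *+ k).
Proof.
suff : cheb (cos t) k * sin t = sin (t *+ k) /\
    cheb (cos t) k.+1 * sin t = sin (t *+ k.+1) by case.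
elim: k => [|k [IH1 IH2]]; first by rewrite mulr0n mulr1n sin0 mul0r mul1r.
split=> //; rewrite chebSS mulrBl IH1 -(mulrA _ (cheb _ _)) IH2.
have -> : t *+ k = t *+ k.+1 - t by rewrite mulrSr addrK.
by rewrite (mulrSr t k.+1) sinB sinD; ring.
Qed.

(** * Positivity of roots (Tits) *)

Section GeometricRepresentation.
Context (R : realType) (n : nat) (m : 'I_n -> 'I_n -> option nat).
Context (W : groupType) (s : 'I_n -> W) (G : 'M[R]_n) (rho : W -> 'M[R]_n).
Hypothesis hW : coxeter_system m s.
Hypothesis hG : coxeter_gram m G.
Hypothesis hrho : geometric_representation G s rho.

Let GT : G^T = G. Proof. by case: hG. Qed.

Lemma geom_rep1 : rho 1%g = 1%:M. Proof. by case: hrho. Qed.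

Lemma geom_repM x y : rho (x * y)%g = rho x *m rho y.
Proof. by case: hrho. Qed.

Lemma geom_rep_gen i v : rho (s i) *m v =
  v - (2 * bform G (simple_root R i) v) *: simple_root R i.
Proof. by case: hrho. Qed.

Lemma coxeter_gen_invol i : (s i * s i = 1)%g.
Proof.
have [mii _ _] := coxeter_system_matrix hW.
by have := coxeter_system_rel hW (mii i); rewrite expg1.
Qed.

Lemma coxeter_gram_diag i : G i i = 1.
Proof.
have [mii _ _] := coxeter_system_matrix hW; have [_ Gcos _] := hG.
by rewrite (Gcos _ _ _ (mii i)) divr1 cospi opprK.
Qed.

Let s_invol := coxeter_gen_invol.
Let s_gen := coxeter_system_gen hW.

Lemma geom_rep_genK i : rho (s i) *m simple_root R i = - simple_root R i.
Proof.
rewrite geom_rep_gen bform_simple_root coxeter_gram_diag mulr1.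
by rewrite scaler_nat mulr2n opprD addrA subrr add0r.
Qed.

Lemma geom_rep_ind (P : 'M[R]_n -> Prop) :
  P 1%:M -> (forall w i, P (rho w) -> P (rho w *m rho (s i))) ->
  forall w, P (rho w).
Proof.
move=> P1 PM w; have := word_lengthP s_invol s_gen w.
move: (word_length s_invol s_gen w) => k; elim: k w => [|k IH] w /=; first by move=> ->; rewrite geom_rep1.
by move=> [h [i [kh ->]]]; rewrite geom_repM; apply/PM/IH.
Qed.

Lemma bform_invariant w u v : bform G (rho w *m u) (rho w *m v) = bform G u v.
Proof.
move: u v; pattern (rho w).
apply: geom_rep_ind w => [|w i IH] u v; first by rewrite !mul1mx.
rewrite -!mulmxA IH !geom_rep_gen !(bformDl, bformDr, bformNl, bformNr, bformZl, bformZr).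
rewrite bform_simple_root coxeter_gram_diag (bformC u (simple_root R i) GT).
by ring.
Qed.

Lemma geom_repVl w u v : bform G (rho w *m u) v = bform G u (rho w^-1%g *m v).
Proof.
by rewrite -(bform_invariant w u) mulmxA -geom_repM mulgV geom_rep1 mul1mx.
Qed.

Lemma alternating_simple_root i j k : let p := cheb (- G i j) in
  rho (alternating s i j k) *m simple_root R i =
    if odd k then p k *: simple_root R i + p k.+1 *: simple_root R j
    else p k.+1 *: simple_root R i + p k *: simple_root R j.
Proof.
move=> p; elim: k => [|k IH].
  by rewrite /= geom_rep1 mul1mx scale0r scale1r addr0.
have Gji : G j i = G i j by rewrite -[in LHS]GT mxE.
rewrite [alternating _ _ _ _]/= geom_repM -mulmxA IH /p chebSS [odd k.+1]/=.
move: (cheb _ k) (cheb _ k.+1) => a b.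
case: (odd k); rewrite /= geom_rep_gen bformDr !bformZr !bform_simple_root
  coxeter_gram_diag ?Gji -scaleNr.
  by rewrite addrAC -scalerDl; congr (_ *: _ + _); ring.
by rewrite -addrA -scalerDl; congr (_ + _ *: _); ring.
Qed.

(** Tits' theorem, by induction on the length: in [w = v * alternating i j k] the dihedral factor
    sends [alpha_i] to a nonnegative combination of [alpha_i] and [alpha_j], and [v], shorter and
    without descent at [i] or [j], keeps both nonnegative. *)
Lemma geom_rep_ascent_ge0 w i :
  (word_length s_invol s_gen w <= word_length s_invol s_gen (w * s i)%g)%N ->
  forall l, 0 <= (rho w *m simple_root R i) l 0.
Proof.
have [N] := ubnP (word_length s_invol s_gen w).
elim: N w i => // N IH w i ltN asc l.
have [[j desc]|no_desc] :=
  pselect (exists j, (word_length s_invol s_gen (w * s j) < word_length s_invol s_gen w)%N);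
  last first.
  have -> : w = 1%g.
    by apply: contra_notP no_desc => w1; exact: exists_descent.
  by rewrite geom_rep1 mul1mx mxE ler0n.
have neq_ij : i != j.
  by apply/negP => /eqP eq_ij; move: desc; rewrite -eq_ij ltnNge asc.
have [v [k [wE ltvw asc_i asc_j k_lt]]] := dihedral_decomposition asc desc.
have [vi vj] : 0 <= (rho v *m simple_root R i) l 0 /\ 0 <= (rho v *m simple_root R j) l 0.
  have ltN' : (word_length s_invol s_gen v < N)%N by exact: leq_trans ltvw ltN.
  by split; exact: IH.
have cheb_ge0 l' : (l' <= k.+1)%N -> 0 <= cheb (- G i j) l'.
  have [_ Gcos Ginf] := hG; have [_ _ m_ge2] := coxeter_system_matrix hW.
  case mij : (m i j) => [d|] le_lk; last by rewrite cheb_ge0_of_ge1 // lerNr Ginf.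
  have d_ge2 := m_ge2 _ _ _ neq_ij mij.
  have lt_kd := k_lt d (ltnW d_ge2) (coxeter_system_rel hW mij).
  rewrite (Gcos _ _ _ mij) opprK; set t := pi / _.
  have d_gt0 : 0 < d%:R :> R by rewrite ltr0n ltnW.
  have t_gt0 : 0 < t by rewrite divr_gt0 ?pi_gt0.
  have sint : 0 < sin t.
    by rewrite sin_gt0_pi // t_gt0 /= ltr_pdivrMr // ltr_pMr ?pi_gt0 // ltr1n.
  (* Indices up to [k.+1] occur; since [k < d], the angle [l' * pi / d] does not exceed [pi]. *)
  rewrite -(pmulr_lge0 _ sint) cheb_cos sin_ge0_pi // mulrn_wge0 ?(ltW t_gt0) //=.
  rewrite -mulr_natr /t mulrAC ler_pdivrMr // ler_pM2l ?pi_gt0 // ler_nat.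
  exact: leq_trans lt_kd.
rewrite wE geom_repM -mulmxA alternating_simple_root.
by case: (odd k); rewrite mulmxDr -!scalemxAr mxE addr_ge0 // mxE mulr_ge0 // cheb_ge0.
Qed.

(** If [i] is a descent of [w], then [w * s i] ascends at [i] and sends [alpha_i] to a nonnegative
    vector, while [s i] negates [alpha_i]. *)
Lemma exists_negative_root w : w <> 1%g ->
  exists i, forall l, (rho w *m simple_root R i) l 0 <= 0.
Proof.
move=> /(exists_descent s_invol s_gen)[i desc]; exists i => l.
have -> : w = (w * s i * s i)%g by rewrite mulgsK.
rewrite geom_repM -mulmxA geom_rep_genK mulmxN mxE oppr_le0.
by apply: geom_rep_ascent_ge0; rewrite mulgsK // ltnW.
Qed.

End GeometricRepresentation.

(** * Spectral theory of the Gram matrix *)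

Section Spectral.
Local Open Scope sesquilinear_scope.

Lemma char_poly_similar (K : fieldType) n (P A : 'M[K]_n) :
  P \in unitmx -> char_poly (invmx P *m A *m P) = char_poly A.
Proof.
move=> Pu; rewrite /char_poly.
have -> : char_poly_mx (invmx P *m A *m P) =
    map_mx polyC (invmx P) *m char_poly_mx A *m map_mx polyC P.
  rewrite /char_poly_mx !map_mxM mulmxBr mulmxBl; congr (_ - _).
  by rewrite scalar_mxC -mulmxA -map_mxM mulVmx // map_mx1 mulmx1.
rewrite !det_mulmx mulrAC -det_mulmx -map_mxM mulVmx // map_mx1 det1.
by rewrite mul1r.
Qed.

(** Serves for the eigenvalues of [G] and for the coordinates of [o]. *)
Lemma seq_pos_lbound (R : realType) (l : seq R) :
  exists2 e : R, 0 < e & forall x, x \in l -> 0 < x -> e <= x.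
Proof.
elim: l => [|y l [e e_gt0 le_e]]; first by exists 1.
have [y_gt0|y_le0] := ltrP 0 y.
  exists (Num.min y e); first by rewrite lt_min y_gt0.
  by move=> x; rewrite inE ge_min => /orP[/eqP->|/le_e H /H ->]; rewrite ?lexx ?orbT.
exists e => // x; rewrite inE => /orP[/eqP-> y_gt0|]; last exact: le_e.
by rewrite leNgt y_gt0 in y_le0.
Qed.

(** Over the complex numbers [G] is Hermitian, hence unitarily diagonalizable with real eigenvalues;
    unique factorization of the characteristic polynomial matches them with [l]. *)
Lemma spectral_real_symmetric (R : realType) n (G : 'M[R]_n) (l : seq R) :
  G^T = G -> char_poly G = \prod_(x <- l) ('X - x%:P) ->
  exists (P : 'M[R[i]]_n) (d : 'I_n -> R),
    [/\ P^t* *m P = 1%:M,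
        map_mx (real_complex R) G =
          P^t* *m diag_mx (\row_i (d i)%:C%C) *m P &
        perm_eq l [seq d i | i <- enum 'I_n]].
Proof.
move=> GT charG; set A := map_mx _ G.
have Aherm : A \is hermsymmx.
  apply: realsym_hermsym; last first.
    by apply/mxOverP => i j; rewrite mxE complex_real.
  by apply/is_hermitianmxP; rewrite expr0 scale1r map_mx_id // /A map_trmx GT.
have /orthomx_spectralP AE := hermitian_normalmx Aherm.
have Punit := spectral_unitarymx A.
have D_real i : spectral_diag A 0 i = (complex.Re (spectral_diag A 0 i))%:C%C.
  by rewrite RRe_real //; move/mxOverP: (hermitian_spectral_diag_real Aherm); apply.
move: AE Punit D_real; set P := spectralmx A; set D := spectral_diag A.
move=> AE Punit D_real.
exists P, (fun i => complex.Re (D 0 i)); split.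
- by rewrite -invmx_unitary // mulVmx // unitarymx_unit.
- rewrite -invmx_unitary // [LHS]AE; congr (_ *m diag_mx _ *m _).
  by apply/rowP => i; rewrite mxE -D_real.
have: perm_eq [seq x%:C%C | x <- l] [seq D 0 i | i <- enum 'I_n].
  apply: prod_XsubC_eq; rewrite 2!big_map big_enum /=.
  have := char_poly_similar (diag_mx D) (unitarymx_unit Punit).
  rewrite -AE (char_poly_trig (diag_mx_is_trig _)) /A -map_char_poly charG map_prod_XsubC.
  move=> ->;  apply: eq_bigr => i _; by rewrite mxE eqxx.
move=> /(perm_map (@complex.Re R)); rewrite -!map_comp.
by rewrite [X in perm_eq X](_ : _ = l) // -[RHS]map_id; exact: eq_map.
Qed.

Local Notation toC := (@real_complex_def _ (Phant _)).

(** In eigencoordinates, [n.-1] positive eigenvalues leave a single index [i0] for [lambda]. Hence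
    [o] has only the coordinate [i0], vectors orthogonal to it have none there, and a lower bound of
    the positive eigenvalues serves as [e]. *)
Lemma signature_complement_pos (R : realType) n (G : 'M[R]_n) (o : 'cV[R]_n) lambda :
  G^T = G -> has_signature G n.-1 1 -> lambda < 0 -> G *m o = lambda *: o ->
  o != 0 ->
  exists2 e : R, 0 < e & forall u : 'cV[R]_n, \sum_i o i 0 * u i 0 = 0 ->
    e * \sum_i u i 0 ^+ 2 <= bform G u u.
Proof.
move=> GT [l [charG pos_l _]] lambda_lt0 Go o_neq0.
have [P [d [PP GE perm_ld]]] := spectral_real_symmetric GT charG.
have [e e_gt0 le_e] := seq_pos_lbound l; exists e => // u ou0.
pose y := P *m map_mx toC o; pose z := P *m map_mx toC u.
have d_l i : d i \in l by rewrite (perm_mem perm_ld) map_f ?mem_enum.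
have PP' : P *m P^t* = 1%:M by exact: mulmx1C.
have dotE (v w : 'cV[R[i]]_n) : (v^t* *m w) 0 0 = \sum_j Num.conj (v j 0) * w j 0.
  by rewrite mxE; apply: eq_bigr => j _; rewrite !mxE.
have conjP (v : 'cV[R]_n) : (map_mx toC v)^t* = map_mx toC v^T.
  by apply/matrixP => i j; rewrite !mxE; exact: conjc_real.
have dotP (v w : 'cV[R]_n) :
    (P *m map_mx toC v)^t* *m (P *m map_mx toC w) = map_mx toC (v^T *m w).
  rewrite trmx_mul map_mxM mulmxA -(mulmxA (_^t*)) PP mulmx1.
  by rewrite conjP map_mxM.
have y_eig i : ((d i)%:C%C - lambda%:C%C) * y i 0 = 0.
  have : P *m (map_mx toC G *m map_mx toC o) = lambda%:C%C *: y.
    by rewrite -map_mxM Go map_mxZ -scalemxAr.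
  rewrite GE !mulmxA PP' mul1mx -mulmxA -/y mul_diag_mx.
  by move=> /matrixP/(_ i 0); rewrite !mxE => H; rewrite mulrBl H subrr.
have [i0 yi0] : exists i0, y i0 0 != 0.
  apply/not_existsP => y0.
  have y0' : y = 0.
    apply/colP => i; rewrite [RHS]mxE; apply/eqP/negPn; apply/negP; exact: y0.
  have : map_mx toC o = 0.
    by rewrite -[LHS]mul1mx -PP -mulmxA -/y y0' mulmx0.
  by move/eqP; rewrite map_mx_eq0; exact/negP.
have di0 : d i0 = lambda.
  have /eqP := y_eig i0; rewrite mulf_eq0 (negPf yi0) orbF subr_eq0.
  by move/eqP/complexI.
(* Otherwise [i0] and [i] would be two indices with nonpositive eigenvalue, while [pos_l] allows
   only one. *)
have d_pos i : i != i0 -> 0 < d i.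
  move=> neq_i; rewrite ltNge; apply/negP => di_le0.
  have : (count (predC (fun x : R => (0 < x)%R)) l <= 1)%N.
    have := count_predC (fun x : R => 0 < x) l; rewrite pos_l.
    have : size l = n.
      by rewrite (perm_size perm_ld) size_map size_enum_ord.
    by move=> -> ; lia.
  rewrite (seq.permP perm_ld) count_map -size_filter.
  rewrite leqNgt => /negP; apply.
  apply: (@uniq_leq_size _ [:: i0; i]); first by rewrite /= inE eq_sym neq_i.
  move=> k; rewrite !inE mem_filter mem_enum /= andbT => /orP[]/eqP->.
    by rewrite di0 -leNgt ltW.
  by rewrite -leNgt.
have y0 i : i != i0 -> y i 0 = 0.
  move=> neq_i; have /eqP := y_eig i; rewrite mulf_eq0 => /orP[|/eqP//].
  rewrite subr_eq0 => /eqP/complexI di.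
  by have := d_pos i neq_i; rewrite di ltNge (ltW lambda_lt0).
(* The unitary [P] preserves the orthogonality of [o] and [u], and [y] vanishes at all coordinates
   but [i0]. *)
have z0 : z i0 0 = 0.
  have yz0 : (y^t* *m z) 0 0 = 0.
    by rewrite dotP mxE mxE; under eq_bigr do rewrite mxE; rewrite ou0.
  move: yz0; rewrite dotE (bigD1 i0) //= big1 => [|i neq_i].
    by move/eqP; rewrite addr0 mulf_eq0 conjC_eq0 (negPf yi0) => /eqP.
  by rewrite y0 // conjC0 mul0r.
have bE : toC (bform G u u) = \sum_i (d i)%:C%C * `|z i 0| ^+ 2.
  transitivity ((z^t* *m (diag_mx (\row_j (d j)%:C%C) *m z)) 0 0).
    transitivity (map_mx toC (u^T *m G *m u) 0 0); first by rewrite [RHS]mxE.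
    by rewrite map_mxM map_mxM GE -conjP /z trmx_mul map_mxM !mulmxA.
  rewrite dotE; move: (z) => v; apply: eq_bigr => i _.
  by rewrite mul_diag_mx mxE mxE normCK [v i 0 * _]mulrC mulrCA.
have nE : toC (\sum_i u i 0 ^+ 2) = \sum_i `|z i 0| ^+ 2.
  transitivity ((z^t* *m z) 0 0).
    by rewrite dotP mxE mxE; under [in RHS]eq_bigr do rewrite mxE -expr2.
  by rewrite dotE; apply: eq_bigr => i _; rewrite normCK mulrC.
rewrite -lecR rmorphM /= nE bE mulr_sumr; apply: ler_sum => i _.
have [->|neq_i] := eqVneq i i0; first by rewrite z0 normr0 expr0n /= !mulr0.
by rewrite ler_wpM2r ?exprn_ge0 // lecR le_e // d_pos.
Qed.
End Spectral.

(** * Limit points and heights *)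

Section FiniteDimensionalLimits.
Context (R : realType) (n : nat).
Implicit Types (X F : set 'cV[R]_n) (p : 'cV[R]_n).

(** Pigeonhole: the cube of half-width [D] is cut into finitely many cells of side [delta], and the
    cell of [f x] determines [x]. *)
Lemma finite_of_separated (T : choiceType) (S : set T) (f : T -> 'cV[R]_n) (D delta : R) :
  0 < delta -> (forall x, S x -> forall l, `|f x l 0| <= D) ->
  (forall x y, S x -> S y -> (forall l, `|f x l 0 - f y l 0| <= delta) -> x = y) ->
  finite_set S.
Proof.
move=> delta_gt0 f_bound f_sep.
pose N := Num.truncn ((D + D) / delta).
pose g x : {ffun 'I_n -> 'I_N.+1} :=
  [ffun l => inord (Num.truncn ((f x l 0 + D) / delta))].
have g_inj : {in S &, injective g}.
  move=> x y; rewrite !inE => Sx Sy gxy; apply: f_sep => // l.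
  have cell z : S z -> 0 <= (f z l 0 + D) / delta /\
      (Num.truncn ((f z l ord0 + D) / delta) < N.+1)%N.
    move=> Sz; have := f_bound z Sz l; rewrite ler_norml => /andP[h1 h2].
    split; first by apply: divr_ge0; [lra | exact: ltW].
    by rewrite ltnS le_truncn // ler_wpM2r ?invr_ge0 ?(ltW delta_gt0) // lerD2r.
  have [x0 xN] := cell x Sx; have [y0 yN] := cell y Sy.
  have := congr1 (fun h : {ffun 'I_n -> 'I_N.+1} => nat_of_ord (h l)) gxy.
  rewrite /= !ffunE !inordK // => txy.
  have /andP[x1 x2] := truncn_itv x0; have /andP[y1 y2] := truncn_itv y0.
  rewrite -txy in y1 y2; rewrite -natr1 in x2 y2.
  move: (_%:R) x1 x2 y1 y2 => t.
  rewrite ler_pdivlMr // ltr_pdivrMr // ler_pdivlMr // ltr_pdivrMr // mulrDl mul1r.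
  move=> x1 x2 y1 y2; rewrite ler_norml; apply/andP; split; lra.
rewrite -(eq_finite_set (inj_card_eq g_inj)).
exact: finite_finset.
Qed.

(** [p] itself may lie in [F], whence the conclusion [y = p] in place of an exclusion. *)
Lemma separated_from_finite F p : finite_set F ->
  exists2 e : R, 0 < e & forall y, F y -> (forall l, `|y l 0 - p l 0| < e) -> y = p.
Proof.
move=> /finite_seqP[r ->]; elim: r => [|z r [e e_gt0 IH]]; first by exists 1.
have [->|neq_zp] := eqVneq z p.
  exists e => // y; rewrite /= inE => /orP[/eqP//|]; exact: IH.
have [l neq_l] : exists l, z l 0 != p l 0.
  apply/not_existsP => eq_zp; move/eqP: neq_zp; apply; apply/colP => l.
  by apply/eqP/negPn/negP; exact: eq_zp.
exists (Num.min e `|z l 0 - p l 0|).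
  by rewrite lt_min e_gt0 normr_gt0 subr_eq0.
move=> y; rewrite /= inE => /orP[/eqP-> /(_ l)|ry near_y].
  by rewrite lt_min ltxx andbF.
by apply: IH => // k; have := near_y k; rewrite lt_min => /andP[].
Qed.

Lemma limit_point_near X p : limit_point X p -> forall e : R, 0 < e ->
  exists y, [/\ y <> p, X y & forall l, `|y l 0 - p l 0| < e].
Proof.
move=> Xp e e_gt0; have [|y [/eqP yp Xy py]] := Xp (ball p e).
  exact: nbhsx_ballx.
exists y; split => // l; have [_ /(_ l 0)] := py.
by rewrite /ball /= distrC.
Qed.

Lemma limit_pointI X p : (forall e : R, 0 < e ->
  exists y, [/\ y <> p, X y & forall l, `|y l 0 - p l 0| < e]) -> limit_point X p.
Proof.
move=> near U /nbhs_ballP[e /= e_gt0 eU]; have [y [yp Xy py]] := near e e_gt0.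
exists y; split => //; first exact/eqP.
by apply: eU; split => // i j; rewrite ord1 /ball /= distrC.
Qed.

(** Applied with [F] the points of bounded height, so that the approximating point has large
    height. *)
Lemma limit_point_avoid X F p : limit_point X p -> finite_set F ->
  forall e : R, 0 < e -> exists y, [/\ X y, ~ F y & forall l, `|y l 0 - p l 0| < e].
Proof.
move=> Xp /(separated_from_finite p)[d d_gt0 Fd] e e_gt0.
have [|y [yp Xy py]] := limit_point_near Xp (e := Num.min d e).
  by rewrite lt_min d_gt0.
exists y; split => // [Fy|l]; last by have := py l; rewrite lt_min => /andP[].
by apply: yp; apply: Fd => // l; have := py l; rewrite lt_min => /andP[].
Qed.

End FiniteDimensionalLimits.

Lemma sqr_le_of_norm_le (R : realType) (x K : R) : `|x| <= K -> x ^+ 2 <= K ^+ 2.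
Proof.
move=> xK; rewrite -real_normK ?num_real // ler_pXn2r ?nnegrE //.
exact: le_trans xK.
Qed.

(** * Euclidean norm, height and bounds for the form *)

Section Norm1.
Context (R : realType) (n : nat).
Implicit Types (o u v : 'cV[R]_n) (G : 'M[R]_n).

Definition sqnorm v : R := \sum_l v l 0 ^+ 2.

Lemma sqr_le_sqnorm v l : v l 0 ^+ 2 <= sqnorm v.
Proof.
by rewrite /sqnorm (bigD1 l) //= lerDl sumr_ge0 // => i _; exact: sqr_ge0.
Qed.

(** The crude estimate [x <= 1 + x ^+ 2] avoids square roots. *)
Lemma norm_le_sqnorm v l : `|v l 0| <= 1 + sqnorm v.
Proof.
have := sqr_le_sqnorm v l; rewrite -real_normK ?num_real //.
by move: `|v l 0| (sqnorm v) => x y; nra.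
Qed.

Lemma norm1D o u v : norm1 o (u + v) = norm1 o u + norm1 o v.
Proof.
by rewrite /norm1 -big_split; apply: eq_bigr => l _; rewrite mxE mulrDr.
Qed.

Lemma norm1Z o a v : norm1 o (a *: v) = a * norm1 o v.
Proof.
by rewrite /norm1 mulr_sumr; apply: eq_bigr => l _; rewrite mxE mulrCA.
Qed.

Lemma norm1N o v : norm1 o (- v) = - norm1 o v.
Proof. by rewrite -scaleN1r norm1Z mulN1r. Qed.

Lemma norm1_le0 o v : (forall l, 0 < o l 0) -> (forall l, v l 0 <= 0) -> norm1 o v <= 0.
Proof.
by move=> o_gt0 v_le0; apply: sumr_le0 => l _; rewrite pmulr_rle0.
Qed.

Lemma normalizeZ o a v : a != 0 -> normalize o (a *: v) = normalize o v.
Proof.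
by move=> a_neq0; rewrite /normalize norm1Z invfM scalerA mulrAC mulVf // mul1r.
Qed.

Definition gram_size G : R := \sum_i \sum_j `|G i j|.

Lemma gram_size_ge0 G : 0 <= gram_size G.
Proof. by apply: sumr_ge0 => i _; apply: sumr_ge0. Qed.

Lemma bform_bound G u v a b : 0 <= a ->
  (forall l, `|u l 0| <= a) -> (forall l, `|v l 0| <= b) ->
  `|bform G u v| <= a * b * gram_size G.
Proof.
move=> a_ge0 ua vb.
have -> : bform G u v = \sum_i \sum_j u i 0 * v j 0 * G i j.
  rewrite /bform mxE exchange_big; apply: eq_bigr => j _; rewrite mxE mulr_suml.
  by apply: eq_bigr => i _; rewrite mxE mulrAC.
rewrite /gram_size mulr_sumr; apply: le_trans (ler_norm_sum _ _ _) _.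
apply: ler_sum => i _; rewrite mulr_sumr; apply: le_trans (ler_norm_sum _ _ _) _.
by apply: ler_sum => j _; rewrite !normrM ler_wpM2r // ler_pM.
Qed.

End Norm1.

(** * Discreteness and comparison of the two limit sets *)

Section LorentzianCoxeterGroup.
Context (R : realType) (n : nat) (m : 'I_n -> 'I_n -> option nat).
Context (W : groupType) (s : 'I_n -> W) (G : 'M[R]_n) (rho : W -> 'M[R]_n).
Context (o : 'cV[R]_n) (lambda e : R).
Hypothesis hW : coxeter_system m s.
Hypothesis hG : coxeter_gram m G.
Hypothesis hrho : geometric_representation G s rho.
Hypothesis lambda_lt0 : lambda < 0.
Hypothesis Go : G *m o = lambda *: o.
Hypothesis o_unit : \sum_i o i 0 ^+ 2 = 1.
Hypothesis o_gt0 : forall i, 0 < o i 0.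
Hypothesis e_gt0 : 0 < e.
Hypothesis bform_complement : forall u : 'cV[R]_n, \sum_i o i 0 * u i 0 = 0 ->
  e * \sum_i u i 0 ^+ 2 <= bform G u u.

Local Notation t := (norm1 o).
Local Notation alpha := (simple_root R).

Let GT : G^T = G. Proof. by case: hG. Qed.
Let lambda_neq0 : lambda != 0. Proof. by rewrite lt_eqF. Qed.

Lemma bform_eigen v : bform G o v = lambda * t v.
Proof.
rewrite (bformC _ _ GT) /bform -mulmxA Go -scalemxAr mxE; congr (_ * _).
by rewrite mxE; apply: eq_bigr => i _; rewrite mxE mulrC.
Qed.

Lemma bform_eigen_simple_root i : bform G o (alpha i) = lambda * o i 0.
Proof. by rewrite (bformC _ _ GT) bform_simple_rootl Go mxE. Qed.

Lemma norm1_eigen : t o = 1.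
Proof. by rewrite -o_unit; apply: eq_bigr => i _; rewrite expr2. Qed.

Lemma eigen_le1 i : o i 0 <= 1.
Proof.
have := sqr_le_sqnorm o i; rewrite /sqnorm o_unit.
by rewrite -[X in _ <= X](expr1n _ 2) ler_pXn2r ?nnegrE ?(ltW (o_gt0 i)) ?ler01.
Qed.

(* The form is negative definite only along [o]: its value and the height
   [t v] together control the Euclidean norm. *)
Lemma sqnorm_bound v : sqnorm v <= t v ^+ 2 + (bform G v v - lambda * t v ^+ 2) / e.
Proof.
pose u := v - t v *: o.
have tu : t u = 0 by rewrite norm1D norm1N norm1Z norm1_eigen mulr1 subrr.
have vE : v = u + t v *: o by rewrite subrK.
clearbody u.
have := bform_complement tu.
have -> : bform G v v = bform G u u + lambda * t v ^+ 2.
  rewrite {1 2}vE !(bformDl, bformDr, bformZl, bformZr) (bformC u o GT).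
  by rewrite !bform_eigen tu norm1_eigen; ring.
have -> : sqnorm v = sqnorm u + 2 * t v * t u + t v ^+ 2 * \sum_i o i 0 ^+ 2.
  rewrite /sqnorm; move: (t v) vE => c ->.
  rewrite [t u]/norm1 !mulr_sumr -!big_split /=; apply: eq_bigr => l _.
  by rewrite !mxE; ring.
rewrite tu o_unit mulr0 addr0 mulr1 addrK addrC lerD2l ler_pdivlMr //.
by rewrite mulrC.
Qed.

(** Up to the factor [lambda], both sides are values of the form on [o] and [rho w *m o], in
    opposite order. *)
Lemma norm1_inv w : t (rho w^-1%g *m o) = t (rho w *m o).
Proof.
apply: (mulfI lambda_neq0); rewrite -!bform_eigen -(geom_repVl hW hG hrho).
exact: bformC.
Qed.

Lemma orbit_sqnorm_bound (K : R) w : `|t (rho w *m o)| <= K ->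
  sqnorm (rho w *m o) <= K ^+ 2 + (lambda - lambda * K ^+ 2) / e.
Proof.
move=> /sqr_le_of_norm_le tK; apply: le_trans (sqnorm_bound _) _.
rewrite (bform_invariant hW hG hrho) bform_eigen norm1_eigen mulr1.
rewrite lerD // ler_wpM2r ?invr_ge0 ?(ltW e_gt0) // lerD2l lerN2.
by rewrite ler_wnM2l // ltW.
Qed.

(** By invariance [lambda * t (w alpha_i)] is the form on [w^-1 o] and [alpha_i], and [w^-1 o] is
    bounded because its height equals that of [w o]. *)
Lemma root_height_bound (K : R) : exists2 C, 0 <= C &
  forall w i, `|t (rho w *m o)| <= K -> `|t (rho w *m alpha i)| <= C.
Proof.
pose C1 := K ^+ 2 + (lambda - lambda * K ^+ 2) / e.
pose C2 := (1 + `|C1|) * 1 * gram_size G.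
have C2_ge0 : 0 <= C2 by rewrite /C2 mulr1 mulr_ge0 ?gram_size_ge0 // addr_ge0.
exists (C2 / - lambda) => [|w i tK]; first by rewrite divr_ge0 // oppr_ge0 ltW.
rewrite ler_pdivlMr ?oppr_gt0 // -(gtr0_norm (x := - lambda)) ?oppr_gt0 //.
rewrite normrN mulrC -normrM -bform_eigen (bformC _ _ GT) (geom_repVl hW hG hrho).
rewrite (bformC _ _ GT). apply: bform_bound => [|l|l].
- by rewrite addr_ge0.
- apply: le_trans (norm_le_sqnorm _ _) _; rewrite lerD2l.
  by apply: le_trans (orbit_sqnorm_bound _) (ler_norm _); rewrite norm1_inv.
- by rewrite mxE; case: eqP; rewrite ?normr1 ?normr0.
Qed.

Lemma root_bound (K : R) : exists2 b, 0 <= b &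
  forall w i l, `|t (rho w *m o)| <= K -> `|(rho w *m alpha i) l 0| <= b.
Proof.
have [C C_ge0 boundC] := root_height_bound K.
exists (1 + (C ^+ 2 + (1 - lambda * C ^+ 2) / e)) => [|w i l tK].
  rewrite addr_ge0 // addr_ge0 ?sqr_ge0 // divr_ge0 ?(ltW e_gt0) //.
  by rewrite subr_ge0 (le_trans _ ler01) // nmulr_rle0 ?sqr_ge0.
apply: le_trans (norm_le_sqnorm _ _) _; rewrite lerD2l.
apply: le_trans (sqnorm_bound _) _.
rewrite (bform_invariant hW hG hrho) bform_simple_root (coxeter_gram_diag hW hG).
have tC2 : t (rho w *m alpha i) ^+ 2 <= C ^+ 2.
  by apply: sqr_le_of_norm_le; exact: boundC.
rewrite lerD // ler_wpM2r ?invr_ge0 ?(ltW e_gt0) // lerD2l lerN2.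
by rewrite ler_wnM2l // ltW.
Qed.

(** These orbit points are bounded, so it suffices to separate them. For [w1 <> w2] a negative root
    [w2^-1 w1 alpha_i] gives [0 <= B(o, w2^-1 w1 alpha_i) = B(w2 o, w1 alpha_i)]; if [w1 o] and
    [w2 o] were close, this value would be close to [B(w1 o, w1 alpha_i) = lambda * o_i < 0]. *)
Lemma finite_bounded_orbit (K : R) : finite_set [set w | `|t (rho w *m o)| <= K].
Proof.
have [b b_ge0 boundb] := root_bound K.
have [c c_gt0 le_c] := seq_pos_lbound [seq o i 0 | i <- enum 'I_n].
have {}le_c i : c <= o i 0.
  by apply: le_c => //; apply/mapP; exists i; rewrite ?mem_enum.
pose g := gram_size G; have g_ge0 : 0 <= g := gram_size_ge0 G.
have bg_gt0 : 0 < b * g + 1 by rewrite ltr_wpDl // mulr_ge0.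
(* Chosen so that the perturbation [delta * b * g] equals [- lambda * c - delta]; the [+ 1] in the
   denominator makes it strictly smaller than [- lambda * c]. *)
pose delta := - lambda * c / (b * g + 1).
have delta_gt0 : 0 < delta by rewrite divr_gt0 // mulr_gt0 // oppr_gt0.
pose D := 1 + (K ^+ 2 + (lambda - lambda * K ^+ 2) / e).
apply: (@finite_of_separated R n W _ (fun w => rho w *m o) D delta) => //=.
  move=> w tK l; apply: le_trans (norm_le_sqnorm _ _) _.
  by rewrite lerD2l orbit_sqnorm_bound.
move=> w1 w2 tK1 _ near12; apply: contrapT => neq12.
have [|i neg] := exists_negative_root hW hG hrho (w := (w2^-1 * w1)%g).
  by move=> /(congr1 (mulg w2)); rewrite mulKVg mulg1.
have : 0 <= bform G o (rho (w2^-1 * w1)%g *m alpha i).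
  by rewrite bform_eigen nmulr_rge0 // norm1_le0.
rewrite (geom_repM hrho) -mulmxA -(geom_repVl hW hG hrho).
rewrite -[rho w2 *m o](addrNK (rho w1 *m o)) bformDl.
rewrite (bform_invariant hW hG hrho) bform_eigen_simple_root.
apply/negP; rewrite -ltNge.
have : `|bform G (rho w2 *m o - rho w1 *m o) (rho w1 *m alpha i)| <= delta * b * g.
  apply: bform_bound => [|l|l]; [exact: ltW | | exact: boundb].
  move: (near12 l); rewrite distrC.
  by move: (rho w1 *m o) (rho w2 *m o) => x y; rewrite !mxE.
move=> /(le_trans (ler_norm _)) h; apply: le_lt_trans (lerD h (lexx _)) _.
have h2 : lambda * o i 0 <= lambda * c by rewrite ler_wnM2l // ltW.
apply: le_lt_trans (lerD (lexx _) h2) _.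
have dE : delta * b * g = - lambda * c - delta.
  by rewrite /delta; field; rewrite lt0r_neq0.
by rewrite dE; lra.
Qed.

Lemma finite_bounded_normalized_orbit (K : R) : finite_set
  [set x | exists2 w, `|t (rho w *m o)| <= K & x = normalize o (rho w *m o)].
Proof.
apply: sub_finite_set (finite_image (fun w => normalize o (rho w *m o))
  (finite_bounded_orbit K)).
by move=> x [w tK ->]; exists w.
Qed.

(* A root is recovered, up to scaling, from its reflection [r]:
   [o - r o = 2 B(root, o) root], and [t (r o) = 1 - 2 lambda (t root)^2]. *)
Lemma finite_bounded_normalized_roots (K : R) : finite_set
  [set x | exists w i, `|t (rho w *m alpha i)| <= K /\ x = normalize o (rho w *m alpha i)].
Proof.
apply: sub_finite_set (finite_image (fun w => normalize o (o - rho w *m o))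
  (finite_bounded_orbit (1 - 2 * lambda * K ^+ 2))).
move=> x [w [i [tK ->]]]; set r := rho w *m alpha i.
pose w' := (w * s i * w^-1)%g.
have w'o : rho w' *m o = o - (2 * (lambda * t r)) *: r.
  rewrite /w' !(geom_repM hrho) -!mulmxA (geom_rep_gen hrho) -(geom_repVl hW hG hrho).
  rewrite -/r (bformC _ _ GT) bform_eigen mulmxBr -scalemxAr -/r; congr (_ - _).
  by rewrite mulmxA -(geom_repM hrho) mulgV (geom_rep1 hrho) mul1mx.
exists w' => /=.
  rewrite w'o norm1D norm1N norm1Z norm1_eigen.
  have tK2 : t r ^+ 2 <= K ^+ 2.
    exact: sqr_le_of_norm_le.
  rewrite (_ : 1 - _ = 1 - 2 * lambda * t r ^+ 2); last by ring.
  have : lambda * K ^+ 2 <= lambda * t r ^+ 2 by rewrite ler_wnM2l // ltW.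
  have : lambda * t r ^+ 2 <= 0 by rewrite nmulr_rle0 ?sqr_ge0.
  by rewrite -!mulrA; move: (lambda * _) (lambda * _) => a b h1 h2; rewrite ger0_norm; lra.
rewrite w'o opprB addrCA subrr addr0.
(* With [t r = 0] both normalizations vanish, since [0^-1 = 0]. *)
have [tr0|tr0] := eqVneq (t r) 0; last by rewrite normalizeZ // !mulf_neq0 // pnatr_eq0.
by rewrite tr0 !mulr0 scale0r /normalize tr0 invr0 scale0r scaler0.
Qed.

(** [t (w o)] is the sum of the [n] heights [t (w alpha_i)] with weights [o_i] between 0 and 1. *)
Lemma exists_high_root (K : R) w : n%:R * K < `|t (rho w *m o)| ->
  exists i, K < `|t (rho w *m alpha i)|.
Proof.
move=> lt_K; apply/not_existsP => all_le; move: lt_K; apply/negP; rewrite -leNgt.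
have -> : t (rho w *m o) = \sum_i o i 0 * t (rho w *m alpha i).
  have oE : o = \sum_i o i 0 *: alpha i.
    apply/colP => l; rewrite summxE (bigD1 l) //= big1 => [|i neq_il].
      by rewrite !mxE !eqxx mulr1 addr0.
    by rewrite !mxE eq_sym (negPf neq_il) mulr0.
  have tsum (I : finType) (F : I -> 'cV[R]_n) : t (\sum_i F i) = \sum_i t (F i).
    by apply: (big_morph t (norm1D o)); rewrite /norm1 big1 // => l _; rewrite mxE mulr0.
  transitivity (t (rho w *m \sum_i o i 0 *: alpha i)); first by rewrite -oE.
  rewrite mulmx_sumr tsum; apply: eq_bigr => i _.
  by rewrite -scalemxAr norm1Z.
apply: le_trans (ler_norm_sum _ _ _) _.
have -> : n%:R * K = \sum_(i < n) K by rewrite sumr_const card_ord mulr_natl.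
apply: ler_sum => i _; rewrite normrM gtr0_norm //.
have : `|t (rho w *m alpha i)| <= K by rewrite leNgt; apply/negP; exact: all_le.
apply: le_trans; rewrite ler_piMl //; exact: eigen_le1.
Qed.

(** * Normalized vectors of large height *)

Lemma bform_normalize v : bform G (normalize o v) (normalize o v) = bform G v v / t v ^+ 2.
Proof. by rewrite bformZl bformZr -exprVn; ring. Qed.

(* Since [B (w o) (w alpha_i) = lambda * o_i] does not depend on [w], two high
   vectors [w o] and [w alpha_i] are nearly isotropic and nearly B-orthogonal,
   which in Lorentzian signature makes their directions close. *)
Lemma high_orbit_root_close p (eps : R) : 0 < eps ->
  exists2 K, 0 < K & forall w i,
    K < `|t (rho w *m o)| -> K < `|t (rho w *m alpha i)| ->
    [/\ normalize o (rho w *m o) <> p, normalize o (rho w *m alpha i) <> p &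
      forall l, `|normalize o (rho w *m o) l 0
                - normalize o (rho w *m alpha i) l 0| < eps].
Proof.
move=> eps_gt0.
(* [1 - lambda] bounds the absolute values [- lambda] and 1 of the form on [w o] and [w alpha_i].
   When [B(p, p)] is nonzero, an inverse squared height below [q] makes the form on the normalized
   vector smaller than [|B(p, p)|]; for isotropic [p] any positive [q] will do. *)
pose q := if bform G p p == 0 then 1 else `|bform G p p| / (1 - lambda).
have q_gt0 : 0 < q.
  rewrite /q; case: eqVneq => // pp; rewrite divr_gt0 ?normr_gt0 //.
  by rewrite subr_gt0 (lt_trans lambda_lt0).
(* The second bound makes [eta * (1 - 2 * lambda)], which dominates the form on [x - y] below, at
   most [eps ^+ 2 * e]. *)
pose eta := Num.min q (eps ^+ 2 * e / (1 - 2 * lambda)).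
have lam2_gt0 : 0 < 1 - 2 * lambda by rewrite subr_gt0 (lt_trans _ ltr01) // pmulr_rlt0.
have eta_gt0 : 0 < eta by rewrite lt_min q_gt0 divr_gt0 // mulr_gt0 // exprn_gt0.
(* As [K] exceeds both [eta^-1] and 1, the product of two heights above [K] exceeds [eta^-1]. *)
pose K := eta^-1 + 1.
have K_gt1 : 1 < K by rewrite ltrDr invr_gt0.
have K_gt0 : 0 < K by rewrite (lt_trans ltr01).
have small x y : K < `|x| -> K < `|y| -> `|(x * y)^-1| < eta.
  move=> Kx Ky; rewrite normrV ?unitfE; last first.
    by rewrite mulf_neq0 // -normr_gt0 (lt_trans K_gt0).
  rewrite normrM -[eta]invrK ltf_pV2 ?posrE ?invr_gt0 //; last first.
    by rewrite mulr_gt0 // (lt_trans K_gt0).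
  apply: (@lt_trans _ _ K); first by rewrite ltrDl.
  apply: (lt_trans Kx); rewrite ltr_pMr ?(lt_trans K_gt0) //.
  exact: lt_trans Ky.
have neq_p v : K < `|t v| -> bform G v v != 0 -> `|bform G v v| <= 1 - lambda ->
    normalize o v <> p.
  move=> Kv vv0 vv1 eq_p; have := bform_normalize v; rewrite eq_p => pp.
  have tv0 : t v != 0 by rewrite -normr_gt0 (lt_trans K_gt0).
  have pp0 : bform G p p != 0 by rewrite pp mulf_neq0 // invr_eq0 expf_neq0.
  have := small _ _ Kv Kv; rewrite lt_min /q (negPf pp0) => /andP[lt_q _].
  move: lt_q; rewrite ltr_pdivlMr; last by rewrite subr_gt0 (lt_trans lambda_lt0).
  rewrite pp normrM mulrC -expr2 ltr_pM2r.
    by rewrite ltNge vv1.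
  by rewrite normr_gt0 invr_eq0 expf_neq0.
exists K => // w i Ka Kb; set a := t _ in Ka; set b := t _ in Kb.
have a_neq0 : a != 0 by rewrite -normr_gt0 (lt_trans K_gt0).
have b_neq0 : b != 0 by rewrite -normr_gt0 (lt_trans K_gt0).
have Boo : bform G (rho w *m o) (rho w *m o) = lambda.
  by rewrite (bform_invariant hW hG hrho) bform_eigen norm1_eigen mulr1.
have Baa : bform G (rho w *m alpha i) (rho w *m alpha i) = 1.
  by rewrite (bform_invariant hW hG hrho) bform_simple_root (coxeter_gram_diag hW hG).
have Boa : bform G (rho w *m o) (rho w *m alpha i) = lambda * o i 0.
  by rewrite (bform_invariant hW hG hrho) bform_eigen_simple_root.
split.
- by apply: neq_p; rewrite // Boo // ltr0_norm // lerDr.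
- by apply: neq_p; rewrite // Baa ?oner_eq0 // normr1 lerDl oppr_ge0 ltW.
move=> l; set x := normalize o _; set y := normalize o _.
have txy : t (x - y) = 0.
  by rewrite norm1D norm1N !norm1Z !mulVf // subrr.
have := bform_complement txy.
have -> : bform G (x - y) (x - y) =
    lambda / a ^+ 2 - 2 * lambda * o i 0 * (a * b)^-1 + (b * b)^-1.
  rewrite !(bformDl, bformDr, bformNl, bformNr) (bformC y x GT).
  rewrite !bform_normalize Boo Baa -/a -/b bformZl bformZr Boa -/a -/b.
  by field; rewrite a_neq0 b_neq0.
move=> le_xy.
(* Of the three terms of the form on [x - y], the first is nonpositive, the second at most
   [eta * (- 2 * lambda)] as [o_i <= 1], and the last below [eta]. *)
have lt_xy : e * (x - y) l 0 ^+ 2 < eps ^+ 2 * e.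
  have le1 : e * (x - y) l 0 ^+ 2 <= e * \sum_k (x - y) k 0 ^+ 2.
    by rewrite ler_pM2l //; exact: sqr_le_sqnorm.
  apply: le_lt_trans le1 _; apply: le_lt_trans le_xy _.
  have eta_le : eta * (1 - 2 * lambda) <= eps ^+ 2 * e.
    by rewrite -ler_pdivlMr // ge_min lexx orbT.
  apply: lt_le_trans eta_le.
  have h0 : lambda / a ^+ 2 <= 0.
    by rewrite nmulr_rle0 // invr_ge0 sqr_ge0.
  have h2 := le_lt_trans (ler_norm _) (small _ _ Kb Kb).
  have h1 : - 2 * lambda * o i 0 * (a * b)^-1 <= eta * (- 2 * lambda).
    have ab := small _ _ Ka Kb.
    have c_ge0 : 0 <= - 2 * lambda by rewrite mulNr oppr_ge0 pmulr_rle0 // ltW.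
    apply: le_trans (_ : - 2 * lambda * o i 0 * eta <= _).
      rewrite ler_wpM2l //; first by rewrite mulr_ge0 // ltW.
      exact: le_trans (ler_norm _) (ltW ab).
    by rewrite [leRHS]mulrC ler_pM2r // ler_piMr // eigen_le1.
  move: (lambda / _) ((b * b)^-1) h0 h2 => A B h0 h2.
  by move: h1; rewrite !mulNr; lra.
rewrite [e * _]mulrC ltr_pM2r // -[X in X < _]real_normK ?num_real // in lt_xy.
move: lt_xy; rewrite ltr_pXn2r ?nnegrE ?normr_ge0 ?(ltW eps_gt0) //.
by move: (x) (y) => x' y'; rewrite !mxE.
Qed.

Lemma limit_set_eq_normalized_roots_limit :
  limit_set rho o = normalized_roots_limit rho o.
Proof.
apply/seteqP; split => p plim; apply: limit_pointI => eps eps_gt0;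
  (have eps2_gt0 : 0 < eps / 2 by rewrite divr_gt0);
  have [K K_gt0 close] := high_orbit_root_close p eps2_gt0.
(* Height above [n * K] yields some high [w alpha_i]; the extra [K] makes [w o] itself high. *)
- have [_ [[w ->] high near]] := limit_point_avoid plim
    (finite_bounded_normalized_orbit (n%:R * K + K)) eps2_gt0.
  have {}high : n%:R * K + K < `|t (rho w *m o)|.
    by rewrite ltNge; apply/negP => low; apply: high; exists w.
  have nK_ge0 : 0 <= n%:R * K by rewrite mulr_ge0 // ltW.
  have [|i highi] := @exists_high_root K w; first by apply: le_lt_trans high; rewrite lerDl ltW.
  have [|_ neq dist] := close w i _ highi.
    by apply: le_lt_trans high; rewrite lerDr.
  exists (normalize o (rho w *m alpha i)); split=> //.
    by exists (rho w *m alpha i) => //; exists w, i.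
  move=> l; have {}dist := dist l; rewrite distrC in dist.
  rewrite [eps]splitr; have := ltrD dist (near l).
  by apply: le_lt_trans; exact: ler_distD.
(* Root height above [C] forces [w o] above height [K]; the extra [K] makes the root high too. *)
- have [C C_ge0 boundC] := root_height_bound K.
  have [_ [[_ [w [i ->]] <-] high near]] := limit_point_avoid plim
    (finite_bounded_normalized_roots (C + K)) eps2_gt0.
  have {}high : C + K < `|t (rho w *m alpha i)|.
    by rewrite ltNge; apply/negP => low; apply: high; exists w, i.
  have highw : K < `|t (rho w *m o)|.
    rewrite ltNge; apply/negP => /(boundC w i) le_C; move: high.
    by apply/negP; rewrite -leNgt (le_trans le_C) // lerDl ltW.
  have [|neq _ dist] := close w i highw.
    by apply: le_lt_trans high; rewrite lerDr.
  exists (normalize o (rho w *m o)); split=> //; first by exists w.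
  move=> l; rewrite [eps]splitr; have := ltrD (dist l) (near l).
  by apply: le_lt_trans; exact: ler_distD.
Qed.

End LorentzianCoxeterGroup.

Theorem theorem1p2 (R : realType) (n : nat) (m : 'I_n -> 'I_n -> option nat)
    (W : groupType) (s : 'I_n -> W) (G : 'M[R]_n)
    (rho : W -> 'M[R]_n) (o : 'cV[R]_n)
    (hW : coxeter_system m s)
    (hG : coxeter_gram m G)
    (hsig : has_signature G n.-1 1)
    (hirr : irreducible_form G)
    (hrho : geometric_representation G s rho)
    (ho : positive_unit_negative_eigenvector G o) :
  limit_set rho o = normalized_roots_limit rho o.
Proof.
have [[lambda lambda_lt0 Go] o_unit o_gt0] := ho; have [GT _ _] := hG.
have o_neq0 : o != 0.
  apply/eqP => o0; have /eqP := o_unit; rewrite big1 => [|i _].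
    by rewrite eq_sym oner_eq0.
  by rewrite o0 mxE expr0n.
have [e e_gt0 compl] := signature_complement_pos GT hsig lambda_lt0 Go o_neq0.
exact: limit_set_eq_normalized_roots_limit hW hG hrho lambda_lt0 Go o_unit o_gt0 e_gt0 compl.
Qed.
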